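(* Let $n\ge1$. The finite representation property holds for the signature $(\langle\ \rangle;,\mathsf A_1,\dots,\mathsf A_n,\cdot,\sqcup)$ for representation by $n$-ary partial functions and for representation by injective $n$-ary partial functions. That is: every finite algebra of this signature that is representable by $n$-ary partial functions is isomorphic to an algebra of $n$-ary partial functions with a finite base; and every finite algebra of this signature that is representable by injective $n$-ary partial functions is isomorphic to an algebra of $n$-ary partial functions that has a finite base and all of whose elements are injective.
   Context: Fix $n\ge 1$; $i$ ranges over $\{1,\dots,n\}$. The signature has an $(n+1)$-ary operation (composition), written $\langle a_1,\dots,a_n\rangle ; b$ (also $\boldsymbol a; b$), unary operations $\mathsf A_1,\dots,\mathsf A_n$, and binary operations $\cdot$ and $\sqcup$. Algebras are nonempty. An $n$-ary partial function on a set $X$ is a set $f\subseteq X^{n+1}$ such that $(\boldsymbol x,y),(\boldsymbol x,z)\in f$ implies $y=z$ (where $\boldsymbol x\in X^n$); it is injective if $(\boldsymbol x,z),(\boldsymbol y,z)\in f$ implies $\boldsymbol x=\boldsymbol y$. An algebra of $n$-ary partial functions of this signature is an algebra whose elements are $n$-ary partial functions, for which there are a set $X$ (the base) and an equivalence relation $E$ on $X$ such that every tuple $(x_1,\dots,x_{n+1})$ in every element lies in $X^{n+1}$ and has pairwise $E$-equivalent entries, and whose operations are $\boldsymbol f; g=\{(\boldsymbol x,z)\in X^{n+1} : \exists \boldsymbol y\in X^n,\ (\boldsymbol x,y_i)\in f_i \text{ for each } i \text{ and } (\boldsymbol y,z)\in g\}$, $\mathsf A_i(f)=\{(\boldsymbol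 x,x_i)\in X^{n+1} : x_1,\dots,x_n \text{ all } E\text{-equivalent and there is no } y\in X \text{ with } (\boldsymbol x,y)\in f\}$, $f\cdot g=f\cap g$, and preferential union: $(f\sqcup g)(\boldsymbol x)$ is $f(\boldsymbol x)$ if $f(\boldsymbol x)$ is defined, $g(\boldsymbol x)$ if $f(\boldsymbol x)$ is undefined but $g(\boldsymbol x)$ is defined, and undefined otherwise. An algebra is representable by (injective) $n$-ary partial functions if it is isomorphic to an algebra of $n$-ary partial functions of the same signature (all of whose elements are injective). *)

(* Defs.v *)
From mathcomp Require Import all_boot.
From mathcomp Require Import boolp classical_sets functions cardinality.
From Stdlib Require Import RelationClasses.

Set Implicit Arguments.
Unset Strict Implicit.
Unset Printing Implicit Defensive.

Local Open Scope classical_set_scope.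

(* Subsets of X^(n+1), with X^(n+1) presented as X^n * X. *)
Definition nary (n : nat) (X : Type) := set (n.-tuple X * X).

Section PartialFunctions.
Variables (n : nat) (X : Type).
Implicit Types (f g : nary n X) (x y : n.-tuple X) (z w : X).

Definition is_partial_function f : Prop :=
  forall x z w, f (x, z) -> f (x, w) -> z = w.

Definition is_injective f : Prop :=
  forall x y z, f (x, z) -> f (y, z) -> x = y.

Definition defined_at f x : Prop := exists z, f (x, z).

Definition composition (f : n.-tuple (nary n X)) g : nary n X :=
  [set p | exists y, (forall i : 'I_n, tnth f i (p.1, tnth y i)) /\ g (y, p.2)].

Variable E : X -> X -> Prop.

Definition equivalent_entries x : Prop :=
  forall i j : 'I_n, E (tnth x i) (tnth x j).

Definition antidomain (i : 'I_n) f : nary n X :=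
  [set p | [/\ p.2 = tnth p.1 i, equivalent_entries p.1 & ~ defined_at f p.1]].

Definition preferential_union f g : nary n X :=
  [set p | f p \/ ~ defined_at f p.1 /\ g p].

(* Pairwise E-equivalence of all n + 1 entries; for n >= 1 and E an equivalence
   relation the two remaining kinds of pairs follow by symmetry and
   reflexivity. *)
Definition within_classes f : Prop :=
  forall x z, f (x, z) ->
    equivalent_entries x /\ (forall i : 'I_n, E (tnth x i) z).

End PartialFunctions.

Record algebra (n : nat) := Algebra {
  carrier :> Type;
  comp : n.-tuple carrier -> carrier -> carrier;
  anti : 'I_n -> carrier -> carrier;
  meet : carrier -> carrier -> carrier;
  punion : carrier -> carrier -> carrier;
  carrier_nonempty : inhabited carrier
}.

Definition is_isomorphism (n : nat) (A B : algebra n) (h : A -> B) : Prop :=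
  [/\ bijective h,
      forall (a : n.-tuple A) (b : A),
        h (comp a b) = comp (map_tuple h a) (h b),
      forall (i : 'I_n) (a : A), h (anti i a) = anti i (h a),
      forall a b : A, h (meet a b) = meet (h a) (h b) &
      forall a b : A, h (punion a b) = punion (h a) (h b)].

Definition isomorphic (n : nat) (A B : algebra n) : Prop :=
  exists h : A -> B, is_isomorphism h.

Record pfun_algebra (n : nat) := PfunAlgebra {
  base : Type;
  eqv : base -> base -> Prop;
  eqv_equivalence : Equivalence eqv;
  elements : set (nary n base);
  elements_nonempty : elements !=set0;
  elements_pfun : forall f, elements f -> is_partial_function f;
  elements_within : forall f, elements f -> within_classes eqv f;
  elements_comp : forall (f : n.-tuple (nary n base)) g,
    (forall i : 'I_n, elements (tnth f i)) -> elements g ->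
    elements (composition f g);
  elements_anti : forall (i : 'I_n) f,
    elements f -> elements (antidomain eqv i f);
  elements_meet : forall f g, elements f -> elements g -> elements (f `&` g);
  elements_punion : forall f g,
    elements f -> elements g -> elements (preferential_union f g)
}.

Section AlgebraOfPartialFunctions.
Variables (n : nat) (P : pfun_algebra n).

Definition element := {f : nary n (base P) | elements f}.

Lemma elements_tuple (f : n.-tuple element) (i : 'I_n) :
  elements (tnth (map_tuple sval f) i).
Proof. by rewrite tnth_map; exact: svalP. Qed.

Lemma element_nonempty : inhabited element.
Proof. by have [f Pf] := elements_nonempty P; exists; exists f. Qed.

Definition algebra_of_pfun : algebra n :=
  @Algebra n element
    (fun f g => exist _ (composition (map_tuple sval f) (sval g))
                  (elements_comp (elements_tuple f) (svalP g)))
    (fun i f => exist _ (antidomain (@eqv n P) i (sval f))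
                  (elements_anti i (svalP f)))
    (fun f g => exist _ (sval f `&` sval g)
                  (elements_meet (svalP f) (svalP g)))
    (fun f g => exist _ (preferential_union (sval f) (sval g))
                  (elements_punion (svalP f) (svalP g)))
    element_nonempty.

Definition finite_base : Prop := finite_set [set: base P].

Definition all_injective : Prop :=
  forall f, @elements n P f -> is_injective f.

End AlgebraOfPartialFunctions.

Definition finite_algebra (n : nat) (A : algebra n) : Prop :=
  finite_set [set: A].

Definition representable (n : nat) (A : algebra n) : Prop :=
  exists P : pfun_algebra n, isomorphic A (algebra_of_pfun P).

Definition injectively_representable (n : nat) (A : algebra n) : Prop :=
  exists P : pfun_algebra n,
    all_injective P /\ isomorphic A (algebra_of_pfun P).

(* Main.v *)
Require Import Defs.
From mathcomp Require Import all_boot.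
From mathcomp Require Import boolp classical_sets functions cardinality.
From Stdlib Require Import RelationClasses.

(** Only finitely many pairs of distinct elements of a finite algebra have to
    be told apart, and a single input tuple [x] tells apart a given pair.  The
    set [outputs P x] of all values at [x] of elements of the algebra is finite,
    since each element contributes at most one value.  If the entries of [x] are
    equivalent, as they are when some element is defined at [x], then
    [outputs P x] contains them, because the total projections, which are the
    antidomains of the empty function, belong to the algebra
    ([outputs_entry]).  The set [outputs P x] is also closed under every element
    of the algebra, because values at tuples of values at [x] are values at [x]
    of compositions ([outputs_closed]).

    On a closed set [Y] of points, restriction of functions respects all the
    operations.  Intersection and preferential union are pointwise; for
    antidomain, a function is defined at a tuple over [Y] exactly when its
    restriction is, the value being in [Y]; and for composition, the
    intermediate values lie in [Y].  Restriction also preserves injectivity.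
    However, restricting to just one closed set may identify elements.

    So one takes a finite set [S] of input tuples that separates all the pairs
    ([finite_separating_set]) and the disjoint union of the sets [outputs P x]
    for [x] in [S], with equivalence confined to the individual summands.  The
    functions act on each summand by restriction, which gives a homomorphism
    ([spread_comp] and its companions); it is injective because [S] separates.
    Here arity at least one ensures that a tuple lives in one definite
    summand. *)

Set Implicit Arguments.
Unset Strict Implicit.
Unset Printing Implicit Defensive.

Local Open Scope classical_set_scope.

(** * Isomorphisms and finiteness *)

Lemma sval_inj (T : Type) (D : T -> Prop) : injective (@sval T D).
Proof. exact: eq_sig_hprop (fun _ => @Prop_irrelevance _). Qed.

Lemma inj_surj_bijective (T U : Type) (h : T -> U) :
  injective h -> (forall y, exists x, h x = y) -> bijective h.
Proof.
move=> hI hS; have [g gK] := choice hS.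
by exists g => // x; apply: hI; rewrite gK.
Qed.

Lemma isomorphic_trans (n : nat) (A B C : algebra n) :
  isomorphic A B -> isomorphic B C -> isomorphic A C.
Proof.
case=> h [hB hc ha hm hp] [k [kB kc ka km kp]]; exists (k \o h); split.
- exact: bij_comp.
- move=> a b /=; rewrite hc kc; congr (Defs.comp _ _).
  by apply: eq_from_tnth => i; rewrite !tnth_map.
- by move=> i a /=; rewrite ha ka.
- by move=> a b /=; rewrite hm km.
- by move=> a b /=; rewrite hp kp.
Qed.

Lemma finite_sig (T : Type) (D : set T) :
  finite_set D -> finite_set [set: {x | D x}].
Proof.
move=> Dfin; have -> : [set: {x | D x}] = sval @^-1` D.
  by apply/seteqP; split=> // -[].
by apply: finite_preimage => // x y _ _; exact: sval_inj.
Qed.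

Lemma finite_element (n : nat) (A : algebra n) (P : pfun_algebra n) :
  finite_algebra A -> isomorphic A (algebra_of_pfun P) ->
  finite_set [set: element P].
Proof.
move=> Afin [h [[g hK gK] _ _ _ _]].
apply: sub_finite_set (finite_image h Afin) => y _.
by exists (g y).
Qed.

(** * Values at a fixed input tuple *)

Section Outputs.
Variables (n : nat) (P : pfun_algebra n).
Implicit Types (f g : nary n (base P)) (x : n.-tuple (base P)).

Definition outputs x : set (base P) :=
  \bigcup_(f in [set: element P]) [set z | sval f (x, z)].

Lemma outputsI f x z : elements f -> f (x, z) -> outputs x z.
Proof. by move=> Pf fxz; exists (exist _ f Pf). Qed.

Lemma outputs_finite x :
  finite_set [set: element P] -> finite_set (outputs x).
Proof.
move=> Pfin; apply: bigcup_finite => // -[f Pf] _ /=.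
have [[z0 fz0]|nf] := pselect (defined_at f x).
  apply: (@sub_finite_set _ _ [set z0]); last exact: finite_set1.
  by move=> z fz; exact: elements_pfun Pf _ _ _ fz fz0.
apply: (@sub_finite_set _ _ set0); last exact: finite_set0.
by move=> z fz; apply: nf; exists z.
Qed.

(** A tuple of values at [x] of functions [f i], fed to [g], gives the value at
    [x] of the composition of [f] with [g]. *)
Lemma outputs_closed x g y z :
  elements g -> (forall i, outputs x (tnth y i)) -> g (y, z) -> outputs x z.
Proof.
move=> Pg xy gyz.
have /choice[f fxy] i : exists f : element P, sval f (x, tnth y i).
  by have [f _] := xy i; exists f.
pose F := [tuple sval (f i) | i < n].
have PF i : elements (tnth F i) by rewrite tnth_mktuple; exact: svalP.
apply: (outputsI (elements_comp PF Pg)).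
by exists y; split=> // i; rewrite tnth_mktuple.
Qed.

(** The empty function is an element, as the intersection of any element with
    one of its antidomains; its antidomain at [i] is the projection to the
    [i]th entry. *)
Lemma outputs_entry x (i : 'I_n) :
  equivalent_entries (@eqv n P) x -> outputs x (tnth x i).
Proof.
move=> xE; have [f Pf] := elements_nonempty P.
have P0 : @elements n P (f `&` antidomain (@eqv n P) i f).
  exact: elements_meet Pf (elements_anti i Pf).
apply: (outputsI (elements_anti i P0)); split=> //= -[z [fz [_ _]]].
by apply; exists z.
Qed.

Definition separating (S : set (n.-tuple (base P))) : Prop :=
  forall f g, elements f -> elements g ->
    (forall x z, S x -> f (x, z) <-> g (x, z)) -> f = g.

Lemma finite_separating_set :
  finite_set [set: element P] -> exists S, finite_set S /\ separating S.
Proof.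
move=> Pfin.
have /choice[T TP] (p : element P * element P) :
    exists T : set (n.-tuple (base P)), finite_set T /\
      ((forall x z, T x -> sval p.1 (x, z) <-> sval p.2 (x, z)) ->
       p.1 = p.2).
  have [eqp|neqp] := pselect (p.1 = p.2).
    by exists set0; split=> //; exact: finite_set0.
  have [x nx] : exists x, ~ (forall z, sval p.1 (x, z) <-> sval p.2 (x, z)).
    apply: contrapT => /forallNP same; apply: neqp; apply: sval_inj.
    by apply/seteqP; split=> -[x z] /=; have /contrapT/(_ z)[] := same x.
  exists [set x]; split; first exact: finite_set1.
  by move=> same; case: nx => z; exact: same.
exists (\bigcup_(p in [set: element P] `*` [set: element P]) T p); split.
  by apply: bigcup_finite => [|p _]; [exact: finite_setX | case: (TP p)].
move=> f g Pf Pg same.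
have [_ sep] := TP (exist _ f Pf, exist _ g Pg).
apply: (proj1_sig_eq (sep _)).
by move=> x z Tx; apply: same; exists (exist _ f Pf, exist _ g Pg).
Qed.

End Outputs.

(** * Disjoint unions of closed sets of points *)

Section DisjointUnion.
Variables (n : nat) (n_gt0 : 0 < n) (P : pfun_algebra n).
Variables (I : Type) (Y : I -> set (base P)).

Hypothesis Y_closed : forall i (f : nary n (base P)) x z,
  elements f -> (forall j, Y i (tnth x j)) -> f (x, z) -> Y i z.

Definition point := {q : I * base P | Y q.1 q.2}.
Definition label (q : point) : I := (sval q).1.
Definition value (q : point) : base P := (sval q).2.

Implicit Types (f g : nary n (base P)) (t : n.-tuple point) (q : point).

Lemma point_eq q r : label q = label r -> value q = value r -> q = r.
Proof.
by case: q r => -[i x] Yx [[j y] Yy] eqij eqxy; apply: sval_inj; congr pair.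
Qed.

Definition point_eqv q r : Prop :=
  label q = label r /\ eqv (value q) (value r).

Lemma point_eqv_equivalence : Equivalence point_eqv.
Proof.
have [Er Es Et] := eqv_equivalence P; split.
- by move=> q; split.
- by move=> q r [qr Eqr]; split; [rewrite qr | exact: Es].
- move=> q r s [qr Eqr] [rs Ers]; split; first by rewrite qr.
  exact: Et Eqr Ers.
Qed.

Definition spread f : nary n point :=
  [set p | (forall i, label (tnth p.1 i) = label p.2)
           /\ f (map_tuple value p.1, value p.2)].

(** The value of [f] at a tuple over one summand lies in that summand, by
    closedness.  Hence cutting [f] down to the summands loses no definedness,
    on which antidomain, preferential union and composition all depend. *)
Lemma spread_lift f t i z : elements f ->
  (forall j, label (tnth t j) = i) -> f (map_tuple value t, z) ->
  exists q, [/\ label q = i, value q = z & spread f (t, q)].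
Proof.
move=> Pf ti fz.
have Yz : Y (i, z).1 (i, z).2.
  apply: (Y_closed Pf) fz => j /=.
  by rewrite tnth_map -(ti j); exact: (svalP (tnth t j)).
by exists (exist _ (i, z) Yz).
Qed.

Lemma spread_defined f t q : elements f ->
  (forall j, label (tnth t j) = label q) ->
  defined_at (spread f) t <-> defined_at f (map_tuple value t).
Proof.
move=> Pf tq; split=> [[r [_ fr]]|[z fz]]; first by exists (value r).
by have [r [_ _ fr]] := spread_lift Pf tq fz; exists r.
Qed.

Lemma spread_pfun f : is_partial_function f -> is_partial_function (spread f).
Proof.
move=> fP t q r [/= tq fq] [/= tr fr]; apply: point_eq.
  by rewrite -(tq (Ordinal n_gt0)) tr.
exact: fP fq fr.
Qed.

Lemma spread_injective f : is_injective f -> is_injective (spread f).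
Proof.
move=> fI t u q [/= tq ft] [/= uq fu]; apply: eq_from_tnth => i.
apply: point_eq; first by rewrite tq uq.
by have /(congr1 (fun s => tnth s i)) := fI _ _ _ ft fu; rewrite !tnth_map.
Qed.

Lemma spread_within f :
  within_classes (@eqv n P) f -> within_classes point_eqv (spread f).
Proof.
move=> fE t q [/= tq /fE[tE tqE]]; split=> [i j|i].
  by split; [rewrite !tq | have := tE i j; rewrite !tnth_map].
by split; [exact: tq | have := tqE i; rewrite tnth_map].
Qed.

Lemma spread_comp (F : n.-tuple (nary n (base P))) g :
  (forall i, elements (tnth F i)) ->
  spread (composition F g) = composition (map_tuple spread F) (spread g).
Proof.
move=> PF; apply/seteqP; split=> -[t q].
  case=> /= tq [y [Fy gy]].
  have /choice[u uP] i : exists u, [/\ label u = label q,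
      value u = tnth y i & spread (tnth F i) (t, u)].
    exact: (spread_lift (PF i) tq (Fy i)).
  exists [tuple u i | i < n]; split=> [i|].
    by rewrite tnth_map tnth_mktuple; case: (uP i).
  split=> [i|] /=; first by rewrite tnth_mktuple; case: (uP i).
  rewrite (_ : map_tuple _ _ = y) //; apply: eq_from_tnth => i.
  by rewrite tnth_map tnth_mktuple; case: (uP i).
case=> u [/= Fu [/= uq gu]]; split=> [i|] /=.
  have := Fu (Ordinal n_gt0); rewrite tnth_map => -[/= -> _].
  exact: uq.
exists (map_tuple value u); split=> // i.
by have := Fu i; rewrite tnth_map => -[_ /=]; rewrite tnth_map.
Qed.

Lemma spread_anti i f : elements f ->
  spread (antidomain (@eqv n P) i f) = antidomain point_eqv i (spread f).
Proof.
move=> Pf; apply/seteqP; split=> -[t q].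
  case=> /= tq [/=]; rewrite tnth_map => qt tE nf.
  split=> /=; first by apply: point_eq.
    by move=> j k; split; [rewrite !tq | have := tE j k; rewrite !tnth_map].
  by move/(spread_defined Pf tq).
case=> /= qt tE nf.
have tq j : label (tnth t j) = label q by rewrite qt; case: (tE j i).
split=> //; split=> /=; first by rewrite tnth_map qt.
  by move=> j k; rewrite !tnth_map; case: (tE j k).
by move/(spread_defined Pf tq).
Qed.

Lemma spread_meet f g : spread (f `&` g) = spread f `&` spread g.
Proof.
by apply/seteqP; split=> -[t q]; [case=> tq [] | case=> -[tq ft] [_ gt]].
Qed.

Lemma spread_punion f g : elements f ->
  spread (preferential_union f g) = preferential_union (spread f) (spread g).
Proof.
move=> Pf; apply/seteqP; split=> -[t q].
  case=> /= tq [fq|[nf gq]]; [by left | right; split=> //].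
  by move/(spread_defined Pf tq).
case=> [[tq fq]|[nf [/= tq gq]]]; first by split=> //; left.
by split=> //; right; split=> // /(spread_defined Pf tq).
Qed.

Let spreads : set (nary n point) := spread @` @elements n P.

Lemma spreads_nonempty : spreads !=set0.
Proof. by have [f Pf] := elements_nonempty P; exists (spread f), f. Qed.

Lemma spreads_pfun h : spreads h -> is_partial_function h.
Proof. by case=> f Pf <-; apply: spread_pfun; exact: elements_pfun. Qed.

Lemma spreads_within h : spreads h -> within_classes point_eqv h.
Proof. by case=> f Pf <-; apply: spread_within; exact: elements_within. Qed.

Lemma spreads_comp (F' : n.-tuple (nary n point)) k :
  (forall i, spreads (tnth F' i)) -> spreads k -> spreads (composition F' k).
Proof.
move=> sF' [g Pg <-].
have /choice[f fP] i : exists f, elements f /\ spread f = tnth F' i.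
  by have [f Pf <-] := sF' i; exists f.
have PF i : elements (tnth [tuple f i | i < n] i).
  by rewrite tnth_mktuple; case: (fP i).
exists (composition [tuple f i | i < n] g); first exact: elements_comp.
rewrite spread_comp //; congr composition.
by apply: eq_from_tnth => i; rewrite tnth_map tnth_mktuple; case: (fP i).
Qed.

Lemma spreads_anti i h : spreads h -> spreads (antidomain point_eqv i h).
Proof.
case=> f Pf <-; exists (antidomain (@eqv n P) i f); first exact: elements_anti.
exact: spread_anti.
Qed.

Lemma spreads_meet h k : spreads h -> spreads k -> spreads (h `&` k).
Proof.
case=> f Pf <- [g Pg <-]; exists (f `&` g); first exact: elements_meet.
exact: spread_meet.
Qed.

Lemma spreads_punion h k :
  spreads h -> spreads k -> spreads (preferential_union h k).
Proof.
case=> f Pf <- [g Pg <-]; exists (preferential_union f g).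
  exact: elements_punion.
exact: spread_punion.
Qed.

Definition spread_algebra : pfun_algebra n :=
  PfunAlgebra point_eqv_equivalence spreads_nonempty spreads_pfun
    spreads_within spreads_comp spreads_anti spreads_meet spreads_punion.

Lemma spread_algebra_injective :
  all_injective P -> all_injective spread_algebra.
Proof. by move=> PI h [f Pf <-]; apply: spread_injective; exact: PI. Qed.

Lemma spread_algebra_isomorphic :
  (forall f g, elements f -> elements g -> spread f = spread g -> f = g) ->
  isomorphic (algebra_of_pfun P) (algebra_of_pfun spread_algebra).
Proof.
move=> spread_inj.
have sP (f : element P) : @elements n spread_algebra (spread (sval f)).
  by exists (sval f) => //; exact: svalP.
exists (fun f : element P => exist _ _ (sP f)); split.
- apply: inj_surj_bijective => [f g /proj1_sig_eq/= fg|[h [f Pf fh]]].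
    by apply: sval_inj; apply: spread_inj fg; exact: svalP.
  by exists (exist _ f Pf); apply: sval_inj.
- move=> F g; apply: sval_inj; rewrite /= spread_comp; last first.
    exact: elements_tuple.
  by congr composition; apply: eq_from_tnth => i; rewrite !tnth_map.
- by move=> i f; apply: sval_inj; apply: spread_anti; exact: svalP.
- by move=> f g; apply: sval_inj; exact: spread_meet.
- by move=> f g; apply: sval_inj; apply: spread_punion; exact: svalP.
Qed.

End DisjointUnion.

(** * Finite bases *)

Lemma finite_base_copy (n : nat) (P : pfun_algebra n) :
  0 < n -> finite_set [set: element P] ->
  exists Q : pfun_algebra n,
    [/\ finite_base Q, all_injective P -> all_injective Q
      & isomorphic (algebra_of_pfun P) (algebra_of_pfun Q)].
Proof.
move=> n_gt0 Pfin; have [S [Sfin Ssep]] := finite_separating_set Pfin.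
pose Y (s : {x | S x}) := outputs (P := P) (sval s).
have Yc s (f : nary n (base P)) y z : elements f ->
    (forall j, Y s (tnth y j)) -> f (y, z) -> Y s z.
  exact: outputs_closed.
exists (spread_algebra n_gt0 Yc); split.
- apply: finite_sig.
  apply: (@sub_finite_set _ _
    (\bigcup_(s in [set: {x | S x}]) (pair s @` Y s))).
    by move=> [s z] /= Yz; exists s => //; exists z.
  apply: bigcup_finite => [|s _]; first exact: finite_sig.
  by apply: finite_image; exact: outputs_finite.
- exact: spread_algebra_injective.
apply: spread_algebra_isomorphic.
(* For x in S and (x, z) in f, both the entries of x and z lie in outputs P x,
   so that (x, z) has a copy in the summand labelled x; there it witnesses
   the difference between the spreads whenever (x, z) is not in g. *)
have half (f g : nary n (base P)) x z : elements f ->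
    spread (Y := Y) f = spread g -> S x -> f (x, z) -> g (x, z).
  move=> Pf fg Sx fxz; have [xE _] := elements_within Pf fxz.
  pose s : {x | S x} := exist _ x Sx.
  pose entry i : point Y :=
    exist _ (s, tnth x i) (outputs_entry (P := P) i xE).
  pose t := [tuple entry i | i < n].
  have tx : map_tuple (@value _ _ _ Y) t = x.
    by apply: eq_from_tnth => i; rewrite tnth_map tnth_mktuple.
  have ts i : label (tnth t i) = s by rewrite tnth_mktuple.
  have := spread_lift Yc Pf ts; rewrite tx => /(_ _ fxz)[q [_ qz]].
  by rewrite fg => -[_ /=]; rewrite tx qz.
move=> f g Pf Pg fg; apply: Ssep => // x z Sx.
by split; apply: half.
Qed.

Theorem corollary7p8 (n : nat) (n_ge1 : 1 <= n) :
  (forall A : algebra n, finite_algebra A -> representable A ->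
     exists P : pfun_algebra n,
       finite_base P /\ isomorphic A (algebra_of_pfun P))
  /\
  (forall A : algebra n, finite_algebra A -> injectively_representable A ->
     exists P : pfun_algebra n,
       [/\ finite_base P, all_injective P & isomorphic A (algebra_of_pfun P)]).
Proof.
split=> A Afin [P].
  move=> AP; have Pfin := finite_element Afin AP.
  have [Q [Qfin _ PQ]] := finite_base_copy n_ge1 Pfin.
  by exists Q; split=> //; exact: isomorphic_trans AP PQ.
case=> PI AP; have Pfin := finite_element Afin AP.
have [Q [Qfin QI PQ]] := finite_base_copy n_ge1 Pfin.
by exists Q; split=> //; [exact: QI | exact: isomorphic_trans AP PQ].
Qed.
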